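(* Let $M\in\{A,L\}$, let $X$ and $Y$ be graphs, and if $M=A$ assume that $X$ and $Y$ are both regular. If a vertex $u$ of $X$ is $C$-sedentary in $X$ (with respect to $M(X)$) with $C>\frac{2}{|V(X)|}$, then $u$ is $\big(C-\frac{2}{|V(X)|}\big)$-sedentary in $X\vee Y$ (with respect to $M(X\vee Y)$).
   Context: Graphs are undirected with positive edge weights, no multiple edges. $A$ is the weighted adjacency matrix and $L=D-A$ the Laplacian ($D$ the diagonal degree matrix). A graph is regular (weighted $k$-regular) if all row sums of its adjacency matrix equal a constant $k$. The join $X\vee Y$ is obtained from the disjoint union of $X$ and $Y$ by joining every vertex of $X$ to every vertex of $Y$ by an edge of weight one. $U_M(t)=e^{itM}$; a vertex $u$ is $C$-sedentary ($0<C\le1$) if $\inf_{t>0}|U_M(t)_{u,u}|\ge C$. *)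

(* Defs.v *)
From HB Require Import structures.
From mathcomp Require Import all_boot all_order all_algebra.
From mathcomp Require Import complex.
From mathcomp Require Import all_classical all_reals all_analysis.

Set Implicit Arguments.
Unset Strict Implicit.
Unset Printing Implicit Defensive.

Import Order.TTheory GRing.Theory Num.Theory numFieldNormedType.Exports.

Local Open Scope classical_set_scope.
Local Open Scope ring_scope.

(* An entry 0 of [adj] means that there is no edge, a positive entry is the
   weight of the edge. Loops (diagonal entries) are not excluded. *)
Record graph (R : realType) (n : nat) := Graph {
  adj : 'M[R]_n;
  adj_sym : forall u v, adj u v = adj v u;
  adj_ge0 : forall u v, 0 <= adj u v }.

Definition degree (R : realType) (n : nat) (X : graph R n) (u : 'I_n) : R :=
  \sum_(v < n) adj X u v.

(* A loop contributes its weight once to [degree], so it cancels out here. *)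
Definition laplacian (R : realType) (n : nat) (X : graph R n) : 'M[R]_n :=
  diag_mx (\row_u degree X u) - adj X.

Definition regular (R : realType) (n : nat) (X : graph R n) : Prop :=
  exists k : R, forall u : 'I_n, \sum_(v < n) adj X u v = k.

Section join.
Variables (R : realType) (m n : nat) (X : graph R m) (Y : graph R n).

Definition join_adj : 'M[R]_(m + n) :=
  block_mx (adj X) (const_mx 1) (const_mx 1) (adj Y).

Lemma join_adj_sym u v : join_adj u v = join_adj v u.
Proof.
by rewrite /join_adj; case: (split_ordP u) => i ->; case: (split_ordP v) => j ->;
  rewrite ?(block_mxEul, block_mxEur, block_mxEdl, block_mxEdr) ?mxE // adj_sym.
Qed.

Lemma join_adj_ge0 u v : 0 <= join_adj u v.
Proof.
by rewrite /join_adj; case: (split_ordP u) => i ->; case: (split_ordP v) => j ->;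
  rewrite ?(block_mxEul, block_mxEur, block_mxEdl, block_mxEdr) ?mxE //
    adj_ge0.
Qed.

(* A vertex u of X is [lshift n u] in the join, a vertex v of Y is
   [rshift m v]. *)
Definition join : graph R (m + n) := Graph join_adj_sym join_adj_ge0.

End join.

Variant matrix_kind := Adjacency | Laplacian.

Definition graph_mx (M : matrix_kind) (R : realType) (n : nat)
    (X : graph R n) : 'M[R]_n :=
  match M with
  | Adjacency => adj X
  | Laplacian => laplacian X
  end.

(* [R[i]^o] is the type of complex numbers with its modulus topology, which
   induces the entrywise topology on matrices. *)
Definition expmx (R : realType) (n : nat) (A : 'M[R[i]^o]_n) :
    'M[R[i]^o]_n :=
  lim (series (fun k : nat => (k`!%:R : R[i]^o)^-1 *: A ^+ k) @ \oo).

Definition transition_mx (R : realType) (n : nat) (A : 'M[R]_n) (t : R) :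
    'M[R[i]^o]_n :=
  expmx (\matrix_(u, v) ('i * (t * A u v)%:C)%C).

Definition sedentary (M : matrix_kind) (R : realType) (n : nat)
    (X : graph R n) (u : 'I_n) (C : R) : Prop :=
  0 < C <= 1 /\
  C <= inf [set ComplexField.Normc.normc (transition_mx (graph_mx M X) t u u)
           | t in [set t : R | 0 < t]].

(* Main.v *)
(* For a real symmetric H the matrix exp(itH) is unitary, and every W with
   H1 W = W H2 satisfies exp(itH1) W = W exp(itH2).  In both cases M(X v Y) has
   diagonal block M(X) + aI at X and constant off-diagonal blocks, and the
   all-ones vector is an eigenvector of M(X), for the eigenvalue p, say.  The
   projection K = I - J/m onto the orthogonal complement of that vector thus
   intertwines M(X) + aI with M(X v Y), through K padded by zeros; so the X-block
   G of exp(itM(X v Y)) satisfies G K = K exp(it(M(X) + aI)), that is,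
     G_uu = (G 1)_u / m + e^{ita} exp(itM(X))_uu - e^{it(a+p)} / m.
   The transposed relation gives K G 1 = 0, so G 1 is a constant vector; its
   entry has modulus at most 1 because exp(itM(X v Y)) preserves the norm of the
   indicator vector of X.  Each of the two error terms is therefore at most 1/m. *)
From HB Require Import structures.
Require Import Defs.
From mathcomp Require Import all_boot all_order all_algebra complex.
From mathcomp Require Import all_classical all_reals all_analysis.
From mathcomp Require Import ring.

Set Implicit Arguments.
Unset Strict Implicit.
Unset Printing Implicit Defensive.

Import Order.TTheory GRing.Theory Num.Theory numFieldNormedType.Exports.

Local Open Scope classical_set_scope.
Local Open Scope ring_scope.
Local Open Scope sesquilinear_scope.

(** * The scalar exponential series at imaginary arguments *)

Definition expi (R : realType) (x : R) : R[i] :=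
  (cos x +i* sin x)%C.

Lemma real_complex_continuous (R : realType) :
  continuous (fun x : R => x%:C%C : R[i]^o).
Proof.
move=> x; apply/cvgrPdist_lt => -[e e'].
(* The radius is a complex number; its positivity forces the imaginary part to vanish, which leaves
   a real epsilon. *)
rewrite ltcE /= => /andP[/eqP -> e0].
near=> y; rewrite -rmorphB normc_def /= ltcE /= eqxx /= expr0n addr0 sqrtr_sqr.
by near: y; apply: cvgr_dist_lt => //; exact: cvg_id.
Unshelve. all: by end_near. Qed.

(** The power ['i ^+ k] is a sign for even [k] and a sign times ['i] for odd [k]; the parity factors
    built into [cos_coeff] and [sin_coeff] select the matching case. *)
Lemma expi_coeffE (R : realType) (x : R) (k : nat) :
  (k`!%:R : R[i])^-1 * ('i * x%:C)%C ^+ k =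
  (cos_coeff x k)%:C%C + 'i%C * (sin_coeff x k)%:C%C.
Proof.
rewrite /cos_coeff /sin_coeff /= exprMn -rmorphXn /=.
have -> : (k`!%:R : R[i])^-1 = (k`!%:R^-1 : R)%:C%C by rewrite fmorphV rmorph_nat.
have -> : ('i%C : R[i]) ^+ k =
    (((~~ odd k)%:R * (-1) ^+ k./2 : R)%:C)%C +
    'i%C * (((odd k)%:R * (-1) ^+ k.-1./2 : R)%:C)%C.
  rewrite -{1}(odd_double_half k) exprD -mul2n exprM sqr_i.
  case: (boolP (odd k)) => ko /=.
    rewrite expr1 !mul0r mul1r add0r rmorphXn rmorphN rmorph1; congr (_ * _ ^+ _).
    (* For odd [k] the rounded halves of [k] and [k.-1] agree. *)
    by case: k ko => //= k; rewrite uphalf_half => /negbTE->.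
  by rewrite !mul0r mul1r rmorph0 mulr0 addr0 mul1r rmorphXn rmorphN rmorph1.
rewrite -exprnP !rmorphM /=; ring.
Qed.

Lemma cvg_series_expi (R : realType) (x : R) :
  series (fun k : nat => (k`!%:R : R[i]^o)^-1 * ('i * x%:C)%C ^+ k) @ \oo
  --> (expi x : R[i]^o).
Proof.
have -> : series (fun k : nat => (k`!%:R : R[i]^o)^-1 * ('i * x%:C)%C ^+ k)
  = fun n => (series (cos_coeff x) n)%:C%C +
      ('i%C : R[i]^o) * (series (sin_coeff x) n)%:C%C.
  apply/funext => n; rewrite /series /= !rmorph_sum mulr_sumr -big_split /=.
  by apply: eq_bigr => k _; rewrite expi_coeffE.
have -> : (expi x : R[i]^o) = (cos x)%:C%C + ('i%C : R[i]^o) * (sin x)%:C%C.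
  by apply/eqP; rewrite eq_complex /=; apply/andP; split; apply/eqP; ring.
have cvgC (f : R^nat) (l : R) : f @ \oo --> l ->
    ((f n)%:C%C : R[i]^o) @[n --> \oo] --> (l%:C%C : R[i]^o).
  by apply: continuous_cvg; exact: real_complex_continuous.
apply: cvgD; [|apply: cvgMl_tmp]; apply: cvgC.
  by rewrite cos.unlock; exact: is_cvg_series_cos_coeff.
by rewrite sin.unlock; exact: is_cvg_series_sin_coeff.
Qed.

Lemma expiD (R : realType) (x y : R) : expi (x + y) = expi x * expi y.
Proof.
rewrite /expi cosD sinD; apply/eqP; rewrite eq_complex /=.
by apply/andP; split; apply/eqP; ring.
Qed.

Lemma norm_expi (R : realType) (x : R) : `|expi x| = 1.
Proof. by rewrite normc_def /= cos2Dsin2 sqrtr1. Qed.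

(** * Exponentials of real symmetric matrices *)

Lemma expmx_cvg (R : realType) (n : nat) (A B : 'M[R[i]^o]_n) :
  series (fun k : nat => (k`!%:R : R[i]^o)^-1 *: A ^+ k) @ \oo --> B -> expmx A = B.
Proof. by move=> AB; apply: cvg_lim => //; exact: norm_hausdorff. Qed.

(** Conjugation by [V] respects powers, so each partial sum of the matrix series combines the fixed
    matrices [P j] with scalar partial sums as coefficients. The limit is then taken in each of
    these finitely many coefficients. *)
Lemma transition_mx_unitary_diag (R : realType) (n : nat) (H : 'M[R]_n)
    (V : 'M[R[i]]_n) (d : 'rV[R]_n) (t : R) :
  V \is unitarymx ->
  map_mx (real_complex R) H = V ^t* *m diag_mx (map_mx (real_complex R) d) *m V ->
  transition_mx H t = V ^t* *m diag_mx (\row_j expi (t * d 0 j)) *m V.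
Proof.
move=> Vu HE; apply: expmx_cvg.
pose P (j : 'I_n) : 'M[R[i]]_n := V ^t* *m delta_mx j j *m V.
have decomp (e : 'rV[R[i]]_n) : V ^t* *m diag_mx e *m V = \sum_j e 0 j *: P j.
  rewrite diag_mx_sum_delta mulmx_sumr mulmx_suml; apply: eq_bigr => j _.
  by rewrite -scalemxAr -scalemxAl.
have powE k : (\matrix_(u, v) ('i * (t * H u v)%:C)%C : 'M[R[i]]_n) ^+ k =
    V ^t* *m diag_mx (\row_j ('i * (t * d 0 j)%:C)%C ^+ k) *m V.
  have -> : (\matrix_(u, v) ('i * (t * H u v)%:C)%C : 'M[R[i]]_n) =
     V ^t* *m diag_mx (\row_j ('i * (t * d 0 j)%:C)%C) *m V.
    have -> : (\matrix_(u, v) ('i * (t * H u v)%:C)%C : 'M[R[i]]_n) =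
       ('i * t%:C)%C *: map_mx (real_complex R) H.
      by apply/matrixP => u v; rewrite !mxE rmorphM mulrA.
    rewrite HE scalemxAl scalemxAr; congr (_ *m _ *m _).
    by apply/matrixP => u v; rewrite !mxE mulrnAr rmorphM mulrA.
  elim: k => [|k IH].
    rewrite expr0.
    have -> : \row_j ('i * (t * d 0 j)%:C)%C ^+ 0 = const_mx 1 :> 'rV[R[i]]_n.
      by apply/matrixP => u v; rewrite !mxE expr0.
    by rewrite diag_const_mx mulmx1 -(invmx_unitary Vu) mulVmx // unitarymx_unit.
  rewrite exprSr IH -[RHS]mulmxA; set D := diag_mx _.
  rewrite -[LHS]/(_ *m _) !mulmxA -[_ *m V *m V ^t*]mulmxA (unitarymxP Vu) mulmx1.
  rewrite -!mulmxA; congr (_ *m _); rewrite !mulmxA; congr (_ *m _).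
  by rewrite mulmx_diag; congr diag_mx; apply/rowP => j; rewrite !mxE exprSr.
rewrite decomp.
have -> : series (fun k : nat => (k`!%:R : R[i]^o)^-1 *:
      (\matrix_(u, v) ('i * (t * H u v)%:C)%C : 'M[R[i]^o]_n) ^+ k) =
    fun N => \sum_j series (fun k : nat =>
        (k`!%:R : R[i]^o)^-1 * ('i * (t * d 0 j)%:C)%C ^+ k) N
      *: (P j : 'M[R[i]^o]_n).
  apply/funext => N; rewrite /series /=.
  under [RHS]eq_bigr do rewrite scaler_suml.
  rewrite exchange_big; apply: eq_bigr => k _.
  rewrite powE decomp scaler_sumr; apply: eq_bigr => j _.
  by rewrite mxE scalerA.
apply: cvg_big; first exact: add_continuous.
by move=> j _; apply: cvgZr_tmp; rewrite mxE; exact: cvg_series_expi.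
Qed.

Lemma symmetric_unitary_diag (R : realType) (n : nat) (H : 'M[R]_n) :
  H^T = H ->
  exists (V : 'M[R[i]]_n) (d : 'rV[R]_n), V \is unitarymx /\
  map_mx (real_complex R) H = V ^t* *m diag_mx (map_mx (real_complex R) d) *m V.
Proof.
move=> Hs; set A := map_mx (real_complex R) H.
have Ah : A \is hermsymmx.
  apply: realsym_hermsym.
    by rewrite is_hermitianmxE expr0 scale1r map_mx_id // /A map_trmx Hs.
  by apply/mxOverP => i j; rewrite mxE complex_real.
(* The eigenvalues of a Hermitian matrix are real, so [Re] loses nothing. *)
exists (spectralmx A), (map_mx (@complex.Re R) (spectral_diag A)).
split; first exact: spectral_unitarymx.
rewrite {1}(orthomx_spectralP (hermitian_normalmx Ah)).
rewrite (invmx_unitary (spectral_unitarymx _)).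
congr (_ *m diag_mx _ *m _); apply/matrixP => i j; rewrite !mxE.
by have /mxOverP/(_ i j)/complex_realP[k ->] := hermitian_spectral_diag_real Ah.
Qed.

Lemma transition_mx_unitary (R : realType) (n : nat) (H : 'M[R]_n) (t : R) :
  H^T = H -> (transition_mx H t : 'M[R[i]]_n) \is unitarymx.
Proof.
move=> /symmetric_unitary_diag[V [d [Vu HE]]].
rewrite (transition_mx_unitary_diag t Vu HE).
rewrite !mul_unitarymx ?trmxC_unitary //; apply/unitarymxP.
rewrite tr_diag_mx map_diag_mx mulmx_diag -diag_const_mx; congr diag_mx.
by apply/rowP => j; rewrite !mxE -normCK norm_expi expr1n.
Qed.

Lemma transition_mx_scalar (R : realType) (n : nat) (a t : R) :
  transition_mx (a%:M : 'M[R]_n) t = (expi (t * a))%:M :> 'M[R[i]]_n.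
Proof.
have V1 : (1%:M : 'M[R[i]]_n) \is unitarymx.
  by apply/unitarymxP; rewrite mul1mx trmx1 map_mx1.
rewrite (transition_mx_unitary_diag t V1 (d := const_mx a)).
  rewrite trmx1 map_mx1 mul1mx mulmx1 -diag_const_mx; congr diag_mx.
  by apply/rowP => j; rewrite !mxE.
by rewrite trmx1 map_mx1 mul1mx mulmx1 map_const_mx diag_const_mx map_scalar_mx.
Qed.

Lemma transition_mx_addr_scalar (R : realType) (n : nat) (H : 'M[R]_n) (a t : R) :
  H^T = H ->
  transition_mx (H + a%:M) t = expi (t * a) *: (transition_mx H t : 'M[R[i]]_n).
Proof.
move=> /symmetric_unitary_diag[V [d [Vu HE]]].
rewrite (transition_mx_unitary_diag t Vu HE).
rewrite (transition_mx_unitary_diag t Vu (d := d + const_mx a)).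
  rewrite scalemxAl scalemxAr; congr (_ *m _ *m _).
  by apply/matrixP => i j; rewrite !mxE mulrnAr mulrDr expiD mulrC.
rewrite !map_mxD map_scalar_mx map_const_mx HE raddfD /= diag_const_mx.
rewrite mulmxDr mulmxDl mul_mx_scalar -scalemxAl.
rewrite -(invmx_unitary Vu) mulVmx ?unitarymx_unit //.
by rewrite scalemx1.
Qed.

(** In eigenbases of [H1] and [H2], where [W] becomes [Z], the hypothesis says that [Z i j] vanishes
    unless the eigenvalues [d1 0 i] and [d2 0 j] coincide. Equal eigenvalues have equal
    exponentials, so [Z] also intertwines the exponentiated diagonals. *)
Lemma transition_mx_intertwine (R : realType) (p q : nat)
    (H1 : 'M[R]_p) (H2 : 'M[R]_q) (W : 'M[R]_(p, q)) (t : R) :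
  H1^T = H1 -> H2^T = H2 -> H1 *m W = W *m H2 ->
  (transition_mx H1 t : 'M[R[i]]_p) *m map_mx (real_complex R) W =
  map_mx (real_complex R) W *m (transition_mx H2 t : 'M[R[i]]_q).
Proof.
move=> /symmetric_unitary_diag[V1 [d1 [V1u H1E]]].
move=> /symmetric_unitary_diag[V2 [d2 [V2u H2E]]].
rewrite (transition_mx_unitary_diag t V1u H1E).
rewrite (transition_mx_unitary_diag t V2u H2E).
move=> /(congr1 (map_mx (real_complex R))); rewrite !map_mxM H1E H2E => HW.
set C := map_mx _ W in HW *.
set Z := V1 *m C *m V2 ^t*.
have V1K (r : nat) (B : 'M[R[i]]_(p, r)) : V1 *m (V1 ^t* *m B) = B.
  by rewrite mulmxA (unitarymxP V1u) mul1mx.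
have V2K (r : nat) (B : 'M[R[i]]_(r, q)) : B *m V2 *m V2 ^t* = B.
  by rewrite -mulmxA (unitarymxP V2u) mulmx1.
have V1K' (r : nat) (B : 'M[R[i]]_(p, r)) : V1 ^t* *m (V1 *m B) = B.
  by rewrite mulmxA -(invmx_unitary V1u) mulVmx ?mul1mx // unitarymx_unit.
have V2K' (r : nat) (B : 'M[R[i]]_(r, q)) : B *m V2 ^t* *m V2 = B.
  by rewrite -mulmxA -(invmx_unitary V2u) mulVmx ?mulmx1 // unitarymx_unit.
have dZ : diag_mx (map_mx (real_complex R) d1) *m Z =
    Z *m diag_mx (map_mx (real_complex R) d2).
  move: HW => /(congr1 (fun B => V1 *m B *m V2 ^t*)).
  by rewrite /= -!mulmxA V1K !mulmxA V2K.
have CE : C = V1 ^t* *m Z *m V2 by rewrite /Z -!mulmxA V1K' mulmxA V2K'.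
clearbody Z.
have eZ : diag_mx (\row_j expi (t * d1 0 j)) *m Z =
    Z *m diag_mx (\row_j expi (t * d2 0 j)).
  rewrite mul_diag_mx mul_mx_diag in dZ *; apply/matrixP => i j.
  have /matrixP/(_ i j) := dZ; rewrite mul_diag_mx mul_mx_diag !mxE.
  have [->|Znz] := eqVneq (Z i j) 0; first by rewrite !mulr0 !mul0r.
  by rewrite mulrC => /(mulfI Znz)/complexI ->; rewrite mulrC.
rewrite CE.
rewrite -!mulmxA V1K !mulmxA V2K; congr (_ *m _); rewrite -!mulmxA; congr (_ *m _).
exact: eZ.
Qed.

Lemma unitarymx_sum_sqr_norm (C : numClosedFieldType) (n : nat)
    (U : 'M[C]_n) (x : 'cV[C]_n) :
  U \is unitarymx ->
  \sum_i `|(U *m x) i 0| ^+ 2 = \sum_i `|x i 0| ^+ 2.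
Proof.
move=> Uu.
have sqE (z : 'cV[C]_n) : \sum_i `|z i 0| ^+ 2 = (z ^t* *m z) 0 0.
  by rewrite mxE; apply: eq_bigr => i _; rewrite !mxE normCK mulrC.
rewrite !sqE trmx_mul map_mxM -mulmxA [U ^t* *m _]mulmxA -(invmx_unitary Uu).
by rewrite mulVmx ?mul1mx // unitarymx_unit.
Qed.

(** * The return amplitude in a block matrix with constant off-diagonal blocks *)

Section join_block.
Variables (R : realType) (m n : nat) (P : 'M[R]_m) (Q : 'M[R]_n) (a b p : R).
Hypotheses (Ps : P^T = P) (Qs : Q^T = Q).
Hypothesis P1 : P *m const_mx 1 = p *: const_mx 1 :> 'cV[R]_m.

(** A common form for both matrices of the join: [a = 0], [b = 1] for adjacency, and [a = n],
    [b = -1] for the Laplacian. *)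
Let N : 'M[R]_(m + n) := block_mx (P + a%:M) (const_mx b) (const_mx b) Q.
Let K : 'M[R]_m := 1%:M - m%:R^-1 *: const_mx 1.
Let ofR := @map_mx R R[i] (real_complex R).

Lemma norm_transition_block (t : R) (u : 'I_m) :
  `|(transition_mx P t : 'M[R[i]]_m) u u| - 2 / m%:R <=
  `|(transition_mx N t : 'M[R[i]]_(m + n)) (lshift n u) (lshift n u)|.
Proof.
(* The vertex [u] witnesses that [m] is nonzero, so [m%:R^-1] is a true inverse. *)
have m0 : (0 < m)%N by case: (m) u => [[]|].
have mR : m%:R != 0 :> R by rewrite pnatr_eq0 -lt0n.
have JE : const_mx 1 = const_mx 1 *m (const_mx 1 : 'cV[R]_m)^T :> 'M[R]_m.
  by apply/matrixP => i j; rewrite !mxE big_ord1 !mxE mulr1.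
have P1' : (const_mx 1 : 'cV[R]_m)^T *m P = p *: (const_mx 1 : 'cV[R]_m)^T.
  by apply: trmx_inj; rewrite trmx_mul trmxK Ps P1 linearZ /= trmxK.
have PJ : P *m const_mx 1 = p *: const_mx 1 :> 'M[R]_m.
  by rewrite JE mulmxA P1 -scalemxAl.
have JP : const_mx 1 *m P = p *: const_mx 1 :> 'M[R]_m.
  by rewrite JE -mulmxA P1' -scalemxAr.
pose PA := P + a%:M.
have PAs : PA^T = PA by rewrite /PA linearD /= tr_scalar_mx Ps.
have Ns : N^T = N by rewrite /N tr_block_mx !trmx_const PAs Qs.
have KPA : K *m PA = PA *m K.
  rewrite /K mulmxBl mulmxBr mul1mx mulmx1 -scalemxAl -scalemxAr.
  by rewrite /PA mulmxDl mulmxDr PJ JP scalar_mxC.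
have Kc (r : nat) (c : R) : K *m (const_mx c : 'M[R]_(m, r)) = 0.
  rewrite /K mulmxBl mul1mx -scalemxAl; apply/matrixP => i j; rewrite !mxE.
  under eq_bigr do rewrite !mxE mul1r.
  by rewrite sumr_const card_ord -[c *+ m]mulr_natl mulKf // subrr.
have Ks : K^T = K by rewrite /K linearB /= linearZ /= trmx_const trmx1.
have cK (r : nat) (c : R) : (const_mx c : 'M[R]_(r, m)) *m K = 0.
  by apply: trmx_inj; rewrite trmx_mul Ks trmx_const Kc trmx0.
have z0 (q r s : nat) (B : 'M[R]_(r, s)) : (0 : 'M[R]_(q, r)) *m B = 0.
  by exact: mul0mx.
have W1 : PA *m row_mx K 0 = (row_mx K 0 : 'M[R]_(m, m + n)) *m N.
  by rewrite mul_mx_row mulmx0 /N mul_row_block !z0 !addr0 Kc KPA.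
have W2 : N *m col_mx K 0 = (col_mx K 0 : 'M[R]_(m + n, m)) *m PA.
  by rewrite [RHS]mul_col_mx z0 /N mul_block_col !mulmx0 !addr0 cK KPA.
(* Intertwining with a scalar matrix evaluates the all-ones matrix times the exponential of [PA] as
   a phase times the all-ones matrix. *)
have W3 : (p + a)%:M *m const_mx 1 = (const_mx 1 : 'M[R]_m) *m PA.
  by rewrite /PA mulmxDr JP mul_mx_scalar mul_scalar_mx -scalerDl.
have {W1} := transition_mx_intertwine t PAs Ns W1.
have {W2} := transition_mx_intertwine t Ns PAs W2.
have {W3} := transition_mx_intertwine t (tr_scalar_mx _ _) PAs W3.
have := transition_mx_unitary t Ns.
rewrite transition_mx_scalar (transition_mx_addr_scalar _ _ Ps).
set UP := (transition_mx P t : 'M[R[i]]_m).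
set UN := (transition_mx N t : 'M[R[i]]_(m + n)).
set e := expi (t * a); set e' := expi _.
rewrite map_row_mx map_col_mx !map_mx0 map_const_mx rmorph1 -/ofR => UNu UJ.
pose G := ulsubmx UN.
have -> : UN (lshift n u) (lshift n u) = G u u by rewrite !mxE.
have UNE : UN = block_mx G (ursubmx UN) (dlsubmx UN) (drsubmx UN) by rewrite submxK.
rewrite {1 2}UNE mul_mx_row mul_row_block mul_block_col mul_col_mx.
rewrite !mulmx0 !mul0mx !addr0.
(* Only the blocks that involve [G] are kept. *)
move=> /eq_col_mx[GK _] /eq_row_mx[KG _].
have KE : ofR K = 1%:M - m%:R^-1 *: const_mx 1.
  rewrite /ofR /K map_mxB map_mx1 map_mxZ map_const_mx /=.
  by rewrite rmorph1 fmorphV rmorph_nat.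
pose g : 'cV[R[i]]_m := G *m const_mx 1.
(* The kernel of [K] consists of constant vectors: [K g = 0] equates every entry of [g] with their
   mean. *)
have gE v : g v 0 = g u 0.
  have : ofR K *m g = 0.
    have oneE : const_mx 1 = ofR (const_mx 1) :> 'cV_m.
      by rewrite /ofR map_const_mx rmorph1.
    by rewrite /g mulmxA -KG -mulmxA oneE /ofR -map_mxM Kc map_mx0 mulmx0.
  rewrite KE mulmxBl mul1mx => /eqP; rewrite subr_eq0 => /eqP ->.
  by rewrite -scalemxAl !mxE; congr (_ * _); apply: eq_bigr => i _; rewrite !mxE.
have g1 : `|g u 0| <= 1.
  (* The image of the indicator of the first block has squared norm [m]. Its first part contributes
     [m] times the squared modulus of [g u 0], and the rest is nonnegative. *)
  have := unitarymx_sum_sqr_norm (col_mx (const_mx 1) 0 : 'cV[R[i]]_(m + n)) UNu.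
  rewrite !big_split_ord /=.
  rewrite [X in X + _](eq_bigr (fun=> `|g u 0| ^+ 2)); last first.
    move=> i _; rewrite {1}UNE mul_block_col !mulmx0 !addr0 col_mxEu.
    by rewrite -/G -/g gE.
  rewrite [X in _ = X + _](eq_bigr (fun=> 1)); last first.
    by move=> i _; rewrite col_mxEu mxE normr1 expr1n.
  rewrite [X in _ = _ + X]big1 ?addr0; last first.
    by move=> i _; rewrite col_mxEd mxE normr0 expr0n.
  rewrite !sumr_const card_ord => sE.
  rewrite -(@expr_le1 _ 2) // -(ler_pMn2r m0) -sE lerDl.
  by apply: sumr_ge0 => i _; rewrite exprn_ge0.
have GuE : e * UP u u = G u u - m%:R^-1 * g u 0 + m%:R^-1 * e'.
  (* Expanding [K] on both sides of [GK] leaves two all-ones products; at [(u, u)] one gives [g u 0]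
     and the other, by [UJ], gives [e']. *)
  move: GK; rewrite KE mulmxBr mulmx1 mulmxBl mul1mx -scalemxAr -scalemxAl.
  rewrite -UJ mul_scalar_mx => /matrixP/(_ u u).
  have gu : (G *m const_mx 1 : 'M[R[i]]_m) u u = g u 0.
    rewrite !mxE; apply: eq_bigr => i _.
    by rewrite [const_mx 1 i u]mxE [const_mx 1 i 0]mxE.
  move: gu; set GJ := G *m _; clearbody g GJ G => gu.
  rewrite !mxE gu mulr1 => /(congr1 (+%R^~ (m%:R^-1 * e'))).
  by rewrite subrK => <-.
have mV : `|m%:R^-1 : R[i]| = m%:R^-1 by rewrite normfV normr_nat.
(* The phase [e] has modulus one, so [GuE] and two triangle inequalities finish, each error term
   costing at most [1 / m]. *)
rewrite [X in X - _](_ : _ = `|e * UP u u|); last by rewrite normrM norm_expi mul1r.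
rewrite lerBlDr GuE (le_trans (ler_normD _ _))// [2 / _]mulrDl addrA.
apply: lerD; last by rewrite normrM norm_expi mulr1 mV mul1r.
apply: (le_trans (ler_normB _ _)); rewrite lerD2l normrM mV mul1r.
by apply: ler_piMr => //; rewrite invr_ge0 ler0n.
Qed.
End join_block.

(** * The matrices of a join in block form *)

Lemma graph_mx_sym (R : realType) (M : matrix_kind) (n : nat) (X : graph R n) :
  (graph_mx M X)^T = graph_mx M X.
Proof.
have As : (adj X)^T = adj X by apply/matrixP => i j; rewrite mxE adj_sym.
by case: M => //=; rewrite /laplacian linearB /= tr_diag_mx As.
Qed.

Lemma laplacian_one (R : realType) (n : nat) (X : graph R n) :
  laplacian X *m const_mx 1 = 0 :> 'cV_n.
Proof.
apply/matrixP => i j; rewrite mulmxBl mul_diag_mx !mxE mulr1.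
under eq_bigr do rewrite mxE mulr1.
by rewrite subrr.
Qed.

(** Each vertex gains one unit edge per vertex of the other graph, which raises its degree by the
    order of that graph. *)
Lemma laplacian_join (R : realType) (m n : nat) (X : graph R m) (Y : graph R n) :
  laplacian (join X Y) =
  block_mx (laplacian X + n%:R%:M) (const_mx (-1))
    (const_mx (-1)) (laplacian Y + m%:R%:M).
Proof.
apply/matrixP => i j; rewrite /laplacian.
rewrite [LHS]mxE [in LHS]mxE [X in _ + X]mxE /degree.
case: (split_ordP i) => i' ->; case: (split_ordP j) => j' -> /=;
  rewrite /join_adj ?(block_mxEul, block_mxEur, block_mxEdl, block_mxEdr) !mxE.
- rewrite eq_lshift big_split_ord /=.
  under eq_bigr do rewrite block_mxEul.
  under [X in (_ + X) *+ _]eq_bigr do rewrite block_mxEur mxE.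
  by rewrite sumr_const card_ord mulrnDl addrAC.
- by rewrite eq_lrshift sub0r.
- by rewrite eq_rlshift sub0r.
- rewrite eq_rshift big_split_ord /=.
  under eq_bigr do rewrite block_mxEdl mxE.
  under [X in (_ + X) *+ _]eq_bigr do rewrite block_mxEdr.
  by rewrite sumr_const card_ord [X in X *+ _]addrC mulrnDl addrAC.
Qed.

Lemma normc_transition_join (R : realType) (M : matrix_kind) (m n : nat)
    (X : graph R m) (Y : graph R n) (t : R) (u : 'I_m) :
  (M = Adjacency -> regular X) ->
  ComplexField.Normc.normc (transition_mx (graph_mx M X) t u u) - 2 / m%:R <=
  ComplexField.Normc.normc
    (transition_mx (graph_mx M (join X Y)) t (lshift n u) (lshift n u)).
Proof.
move=> regX.
have [Q [a [b [p [Qs P1 ->]]]]] : exists (Q : 'M[R]_n) (a b p : R),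
    [/\ Q^T = Q, graph_mx M X *m const_mx 1 = p *: const_mx 1 :> 'cV_m &
     graph_mx M (join X Y) =
     block_mx (graph_mx M X + a%:M) (const_mx b) (const_mx b) Q].
  case: M regX => [/(_ erefl)[k kE]|_].
    (* Regularity makes the all-ones vector an eigenvector, with the common row sum as
       eigenvalue. *)
    exists (adj Y), 0, 1, k; split; first exact: (@graph_mx_sym R Adjacency).
      apply/matrixP => i j; rewrite !mxE mulr1 -(kE i).
      by apply: eq_bigr => v _; rewrite mxE mulr1.
    by rewrite raddf0 addr0.
  (* Laplacian rows sum to zero, hence the eigenvalue [0]. *)
  exists (laplacian Y + m%:R%:M), n%:R, (-1), 0; split.
  - by rewrite linearD /= tr_scalar_mx (@graph_mx_sym R Laplacian).
  - by rewrite scale0r laplacian_one.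
  - exact: laplacian_join.
have := norm_transition_block a b (graph_mx_sym M X) Qs P1 t u.
(* The norm on [R[i]] is itself valued in [R[i]]; with [2 / m%:R] written as an embedded real,
   [lecR] brings the inequality back to [R]. *)
rewrite -[2 / _](_ : (2 / m%:R : R)%:C%C = _); last first.
  by rewrite rmorphM fmorphV !rmorph_nat.
by rewrite -rmorphB lecR.
Qed.

Theorem theorem45 (R : realType) (M : matrix_kind) (m n : nat)
    (X : graph R m) (Y : graph R n) (u : 'I_m) (C : R) :
  (M = Adjacency -> regular X /\ regular Y) ->
  sedentary M X u C ->
  2 / m%:R < C ->
  sedentary M (join X Y) (lshift n u) (C - 2 / m%:R).
Proof.
move=> reg [/andP[C0 C1] Cinf] mC; split.
  by rewrite subr_gt0 mC lerBlDr ler_wpDr// divr_ge0.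
(* The time [t = 1] shows that the set of moduli is nonempty, so its [inf] is not a default
   value. *)
apply: lb_le_inf => [|_ [t t0 <-]]; first by eexists; exists 1 => //=; exact: ltr01.
apply: le_trans (normc_transition_join Y t u (fun Me => (reg Me).1)).
rewrite lerD2r (le_trans Cinf)//; apply: ge_inf; last by exists t.
(* Moduli are bounded below by [0], so the infimum for [X] bounds each of them from below. *)
by exists 0 => _ [s _ <-]; case: (transition_mx _ _ _ _) => x y /=; exact: sqrtr_ge0.
Qed.
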